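(* Let $N$ be a positive integer and let $A=(a_{j-k})_{j,k=0}^N$ be an $(N+1)\times(N+1)$ complex self-adjoint Toeplitz matrix (so $a_{-n}=\overline{a_n}$). Let $\mathcal{G}_A$ be the set of functions $f\in L^\infty(\mathbb{T})$ with $\hat f(n)=a_n$ for $n=-N,\dots,N$, and let $c_A=\min\{\|f\|_\infty : f\in\mathcal{G}_A\}$. Then there is a unique function in $\mathcal{G}_A$ of minimum $L^\infty$-norm, and it is an alternating step function of height $c_A$ and order at most $N$ (in the order $0$ case: a constant function whose absolute value is $c_A$).
   Context: $\mathbb{T}$ is the unit circle with normalized Lebesgue measure; $\hat f(n)=\frac{1}{2\pi}\int_0^{2\pi} f(e^{i\theta})e^{-in\theta}\,d\theta$. The minimum defining $c_A$ is attained. For $c>0$ and $n$ a positive integer, an alternating step function of height $c$ and order $n$ is a function in $L^\infty(\mathbb{T})$ that assumes (a.e.) alternately the values $c$ and $-c$ on $2n$ (nondegenerate) subarcs forming a partition of $\mathbb{T}$. An alternating step function of order $0$ is a constant function, and its height is defined to be that constant. *)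

(* Defs.v *)
From mathcomp Require Import all_boot all_order all_algebra.
From mathcomp Require Import all_classical all_reals all_analysis.
From mathcomp Require Export complex.
Set Implicit Arguments. Unset Strict Implicit. Unset Printing Implicit Defensive.
Import Order.TTheory GRing.Theory Num.Theory.
Local Open Scope ring_scope.
Local Open Scope classical_set_scope.
Local Open Scope complex_scope.

Section Circle.
Variable R : realType.

(* The unit circle T is parametrized by theta in [0, 2 pi[ ;
   Lebesgue measure there (normalization enters only via the Fourier coefficients). *)
Definition circD : set R := `[0, pi *+ 2[.

Definition cintegral (f : R -> R[i]) : R[i] :=
  (Rintegral lebesgue_measure circD (fun t => complex.Re (f t)))%:C
  + 'i * (Rintegral lebesgue_measure circD (fun t => complex.Im (f t)))%:C.

Definition fourier (f : R -> R[i]) (n : int) : R[i] :=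
  ((pi *+ 2)^-1)%:C *
  cintegral (fun t => f t * (cos (n%:~R * t) +i* (- sin (n%:~R * t)))).

Definition is_Linf (f : R -> R[i]) : Prop :=
  [/\ measurable_fun circD (fun t => complex.Re (f t)),
      measurable_fun circD (fun t => complex.Im (f t)) &
      exists M : R, \forall x \ae lebesgue_measure, circD x -> `|f x| <= M%:C].

Definition linf_norm (f : R -> R[i]) : R :=
  inf [set M : R | \forall x \ae lebesgue_measure, circD x -> `|f x| <= M%:C].

Definition GA (N : nat) (a : int -> R[i]) (f : R -> R[i]) : Prop :=
  is_Linf f /\ forall n : int, - (N%:Z) <= n <= N%:Z -> fourier f n = a n.

Definition cA (N : nat) (a : int -> R[i]) : R :=
  inf [set linf_norm f | f in GA N a].

(* alternating step function of height c > 0 and order n >= 1: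
   breakpoints 0 <= t_0 < t_1 < ... < t_{2n-1} < 2pi cut the circle into 2n
   nondegenerate arcs [t_i, t_{i+1}[ (i < 2n-1) and the wrap-around arc
   [t_{2n-1}, 2pi[ u [0, t_0[ ; f takes a.e. alternately the values s*c and -s*c
   on consecutive arcs (s = 1 or s = -1). *)
Definition alt_step (c : R) (n : nat) (f : R -> R[i]) : Prop :=
  0 < c /\ (0 < n)%N /\
  exists (t : nat -> R) (s : R),
    [/\ s = 1 \/ s = -1,
        0 <= t 0%N,
        (forall i : nat, (i < (n.*2).-1)%N -> t i < t i.+1),
        t (n.*2).-1 < pi *+ 2 &
        \forall x \ae lebesgue_measure, circD x ->
           (forall i : nat, (i < (n.*2).-1)%N -> t i <= x < t i.+1 ->
               f x = (s * c * (-1) ^+ i)%:C)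
           /\ ((x < t 0%N \/ t (n.*2).-1 <= x) -> f x = (- (s * c))%:C)].

Definition const_fun (z : R[i]) (f : R -> R[i]) : Prop :=
  \forall x \ae lebesgue_measure, circD x -> f x = z.

End Circle.

(* Main.v *)
(* The statement is dual to an L^1 problem in finite dimension. For f in G_A the integral of
   (Re f) p against a real trigonometric polynomial p of degree at most N is a linear form L(p)
   that depends only on A. Maximizing L(p) / ||p||_1 over the compact unit sphere of coefficient
   vectors gives p_0 and c with L(p) <= c ||p||_1, with equality at p_0. The first variation at p_0
   says that f = c sgn(p_0) has the prescribed coefficients, and L(p_0) = c ||p_0||_1 forces
   ||g||_oo >= c for each g in G_A, with equality only if Re g = c sgn(p_0) and Im g = 0 a.e.
   Finally e^{iNt} p_0(t) is a polynomial of degree at most 2N in e^{it}, so p_0 has at most 2N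
   zeros on the circle, and by periodicity it changes sign an even number of times. *)

Require Import Defs.
From mathcomp Require Import all_boot all_order all_algebra.
From mathcomp Require Import all_classical all_reals all_analysis.
From mathcomp Require Import complex measurable_realfun lra ring zify.
Set Implicit Arguments. Unset Strict Implicit. Unset Printing Implicit Defensive.
Import Order.TTheory GRing.Theory Num.Theory.
Import numFieldNormedType.Exports.
Local Open Scope ring_scope.
Local Open Scope classical_set_scope.
Local Open Scope complex_scope.

(** A perturbation smaller than y cannot move it across 0. This gives pointwise convergence of the
    perturbed signs in the first variation. *)
Lemma sgrD_small (R : realDomainType) (y z : R) : `|z| < `|y| ->
  Num.sg (y + z) = Num.sg y.
Proof.
have [y0|y0|->] := ltrgt0P y; last by rewrite normr_lt0.
  by rewrite ltr_norml => /andP[h _]; rewrite !gtr0_sg// -ltrBlDl sub0r.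
by rewrite ltr_norml opprK => /andP[_ h]; rewrite !ltr0_sg// -ltrBrDl sub0r.
Qed.

(** * Integration over the circle and the pairing of bounded with integrable functions *)

Section CircleIntegral.
Variable R : realType.
Local Notation mu := (@lebesgue_measure R).
Local Notation D := (@circD R).

Lemma measurable_circD : measurable D.
Proof. exact: measurable_itv. Qed.
Hint Resolve measurable_circD : core.

Lemma pi2_gt0 : 0 < (pi *+ 2 : R).
Proof. by rewrite mulrn_wgt0 ?pi_gt0. Qed.

Lemma lebesgue_circD : mu D = (pi *+ 2)%:E.
Proof. by rewrite /circD lebesgue_measure_itv/= lte_fin pi2_gt0 oppr0 adde0. Qed.

Lemma ae_circS (P Q : R -> Prop) : (\forall x \ae mu, D x -> P x) ->
  (forall x, D x -> P x -> Q x) -> \forall x \ae mu, D x -> Q x.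
Proof.
move=> h PQ; have H x : (D x -> P x) -> D x -> Q x by move=> xP Dx; exact: PQ (xP Dx).
by have F := ae_filter_ringOfSetsType mu; exact: filterS H h.
Qed.

Lemma ae_circS2 (P Q S : R -> Prop) : (\forall x \ae mu, D x -> P x) ->
  (\forall x \ae mu, D x -> Q x) ->
  (forall x, D x -> P x -> Q x -> S x) -> \forall x \ae mu, D x -> S x.
Proof.
move=> hP hQ PQS; have H x : (D x -> P x) -> (D x -> Q x) -> D x -> S x.
  by move=> xP xQ Dx; exact: PQS (xP Dx) (xQ Dx).
by have F := ae_filter_ringOfSetsType mu; exact: filterS2 H hP hQ.
Qed.

Lemma ae_bounded_integrable (f : R -> R) (M : R) : measurable_fun D f ->
  (\forall x \ae mu, D x -> `|f x| <= M) -> mu.-integrable D (EFin \o f).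
Proof.
move=> mf fM; apply/integrableP; split; first exact/measurable_EFinP.
apply: (@le_lt_trans _ _ ((Num.max M 0)%:E * mu D)%E).
  apply: integral_le_bound => //; first exact/measurable_EFinP.
    by rewrite lee_fin le_max lexx orbT.
  by apply: (ae_circS fM) => x _ fx; rewrite /= lee_fin le_max fx.
by rewrite lebesgue_circD -EFinM ltry.
Qed.

Lemma bounded_integrable (f : R -> R) (M : R) : measurable_fun D f ->
  (forall x, `|f x| <= M) -> mu.-integrable D (EFin \o f).
Proof.
by move=> mf fM; apply: (ae_bounded_integrable mf); apply: aeW => x _.
Qed.

Lemma measurable_fun_sgr (f : R -> R) : measurable_fun D f ->
  measurable_fun D (fun x => Num.sg (f x)).
Proof.
move=> mf; have : measurable_fun setT (@Num.sg R); last first.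
  by move=> msg; exact: measurableT_comp.
rewrite (_ : @Num.sg R = fun x => if 0 < x then 1 else if x < 0 then -1 else 0).
  apply: measurable_fun_ifT => //; first exact: measurable_fun_ltr.
  by apply: measurable_fun_ifT => //; exact: measurable_fun_ltr.
by apply/funext => x; case: sgrP.
Qed.

Lemma finite_ae (P : R -> Prop) (s : seq R) :
  (forall x, D x -> x \notin s -> P x) -> \forall x \ae mu, D x -> P x.
Proof.
move=> sP; have cs : countable [set` s] by apply: finite_set_countable; exact: finite_seq.
exists [set` s]; split.
- exact: countable_measurable.
- exact: countable_lebesgue_measure0.
- move=> x /= /not_implyP[Dx nPx]; apply: contrapT => /negP xs.
  exact/nPx/sP.
Qed.

Lemma Rintegral_circ_cst (r : R) : \int[mu]_(x in D) r = r * (pi *+ 2).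
Proof.
rewrite Rintegral_cst; last exact: measurable_circD.
congr (r * _); exact: (congr1 fine lebesgue_circD).
Qed.

Lemma Rintegral_sum m (F : 'I_m -> R -> R) :
  (forall i, mu.-integrable D (EFin \o F i)) ->
  \int[mu]_(x in D) (\sum_i F i x) = \sum_i \int[mu]_(x in D) F i x.
Proof.
elim: m F => [F _|m ih F iF].
  under eq_Rintegral do rewrite big_ord0.
  by rewrite big_ord0 Rintegral_cst// mul0r.
under eq_Rintegral do rewrite big_ord_recl.
rewrite big_ord_recl RintegralD ?ih//.
have -> : EFin \o (fun x => \sum_(i < m) F (lift ord0 i) x) =
    (fun x => \sum_(i < m) (F (lift ord0 i) x)%:E)%E.
  by apply/funext => x /=; rewrite sumEFin.
apply: (@integrable_sum _ _ R mu D measurable_circD _ (index_enum _) xpredT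
  (fun (i : 'I_m) x => (F (lift ord0 i) x)%:E)) => i _.
exact: iF.
Qed.

Lemma ae_circ_ex (P : R -> Prop) :
  (\forall x \ae mu, D x -> P x) -> exists2 x, D x & P x.
Proof.
move=> [A [mA A0 PA]]; apply: contrapT => nP.
have : mu D = 0%E.
  apply: (subset_measure0 (B := A)) => //.
  by move=> x Dx; apply: PA => /= /(_ Dx) Px; apply: nP; exists x.
by rewrite lebesgue_circD => -[] /eqP; rewrite gt_eqF ?pi2_gt0.
Qed.

Lemma ae_Rintegral_ge0 (h : R -> R) : measurable_fun D h ->
  (\forall x \ae mu, D x -> 0 <= h x) -> 0 <= \int[mu]_(x in D) h x.
Proof.
move=> mh h0; have -> : \int[mu]_(x in D) h x = \int[mu]_(x in D) `|h x|.
  congr fine; apply: ae_eq_integral => //; [exact/measurable_EFinP| |].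
    exact/measurable_EFinP/measurableT_comp.
  by apply: (ae_circS h0) => x _ ?; rewrite /= ger0_norm.
exact: Rintegral_ge0.
Qed.

(** Hölder's inequality for the exponents infinity and 1, one-sided. It yields the lower bound c for
    the norm of every competitor. *)
Lemma Rintegral_mul_le (c : R) (f p : R -> R) :
  measurable_fun D f -> (\forall x \ae mu, D x -> `|f x| <= c) ->
  measurable_fun D p -> (exists M, forall x, `|p x| <= M) ->
  \int[mu]_(x in D) (f x * p x) <= c * \int[mu]_(x in D) `|p x|.
Proof.
move=> mf fc mp [M pM].
have ip : mu.-integrable D (EFin \o (fun x => `|p x|)).
  apply: (@bounded_integrable _ M); first exact: measurableT_comp.
  by move=> x; rewrite normr_id.
have icp : mu.-integrable D (EFin \o (fun x => c * `|p x|)).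
  exact: (@integrableZl _ _ R mu D measurable_circD c _ ip).
have ifp : mu.-integrable D (EFin \o (fun x => f x * p x)).
  apply: (@ae_bounded_integrable _ (c * M)); first exact: measurable_funM.
  by apply: (ae_circS fc) => x _ fx; rewrite normrM ler_pM.
rewrite -subr_ge0 -RintegralZl// -RintegralB//; apply: ae_Rintegral_ge0.
  by apply: measurable_funB; apply: measurable_funM => //; exact: measurableT_comp.
apply: (ae_circS fc) => x _ fx; rewrite subr_ge0.
by rewrite (le_trans (ler_norm _))// normrM ler_wpM2r.
Qed.

(* Equality case of [int f p <= c int |p|]: the integrand [c|p| - f p] is nonnegative with zero integral. *)
Lemma extremal_sgr_ae (c : R) (f p : R -> R) :
  measurable_fun D f -> (\forall x \ae mu, D x -> `|f x| <= c) ->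
  measurable_fun D p -> (exists M, forall x, `|p x| <= M) ->
  (\forall x \ae mu, D x -> p x != 0) ->
  \int[mu]_(x in D) (f x * p x) = c * \int[mu]_(x in D) `|p x| ->
  \forall x \ae mu, D x -> f x = c * Num.sg (p x).
Proof.
move=> mf fc mp [M pM] p0 E.
have mh : measurable_fun D (fun x => c * `|p x| - f x * p x).
  by apply: measurable_funB; apply: measurable_funM => //; exact: measurableT_comp.
have ip : mu.-integrable D (EFin \o (fun x => `|p x|)).
  apply: (@bounded_integrable _ M); first exact: measurableT_comp.
  by move=> x; rewrite normr_id.
have icp : mu.-integrable D (EFin \o (fun x => c * `|p x|)).
  exact: (@integrableZl _ _ R mu D measurable_circD c _ ip).
have ifp : mu.-integrable D (EFin \o (fun x => f x * p x)).
  apply: (@ae_bounded_integrable _ (c * M)); first exact: measurable_funM.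
  by apply: (ae_circS fc) => x _ fx; rewrite normrM ler_pM.
have ih := @integrableB _ _ R mu D measurable_circD _ _ icp ifp.
have h0 : \int[mu]_(x in D) (c * `|p x| - f x * p x) = 0.
  by rewrite RintegralB// RintegralZl// E subrr.
have hae : \forall x \ae mu, D x -> 0 <= c * `|p x| - f x * p x.
  apply: (ae_circS fc) => x _ fx; rewrite subr_ge0.
  by rewrite (le_trans (ler_norm _))// normrM ler_wpM2r.
(* The vanishing criterion concerns the integral of an absolute value, which agrees with this
   integral because the integrand is a.e. nonnegative. *)
have habs : (\int[mu]_(x in D) `|(c * `|p x| - f x * p x)%:E| = 0)%E.
  have <- : (\int[mu]_(x in D) (c * `|p x| - f x * p x)%:E = 0)%E.
    rewrite -[LHS]fineK ?[X in X%:E]h0//.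
    exact: integrable_fin_num.
  apply: ae_eq_integral => //; [exact/measurableT_comp/measurable_EFinP|exact/measurable_EFinP|].
  by apply: (ae_circS hae) => x _ ?; rewrite /= ger0_norm.
have mhE : measurable_fun D (EFin \o (fun x => c * `|p x| - f x * p x)).
  exact/measurable_EFinP.
have := (ae_eq_integral_abs mu measurable_circD mhE).1 habs.
move=> hz; apply: (ae_circS2 p0 hz) => x _ px [/eqP].
rewrite subr_eq0 => /eqP cp; apply: (mulIf px).
by rewrite -cp -mulrA -normrEsg.
Qed.

(** If the integral were 0, the constant -1 paired with |p| would be an equality case of the Hölder
    bound, and [extremal_sgr_ae] would give -1 = sgn |p| = 1 almost everywhere. *)
Lemma Rintegral_norm_gt0 (p : R -> R) : measurable_fun D p ->
  (exists M, forall x, `|p x| <= M) -> (\forall x \ae mu, D x -> p x != 0) ->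
  0 < \int[mu]_(x in D) `|p x|.
Proof.
move=> mp [M pM] p0.
rewrite lt_neqAle Rintegral_ge0 ?andbT; last by move=> x _; exact: normr_ge0.
apply/eqP => n0.
have mn : measurable_fun D (fun x => `|p x|) by exact: measurableT_comp.
have in_ : mu.-integrable D (EFin \o (fun x => `|p x|)).
  by apply: (@bounded_integrable _ M) => // x; rewrite normr_id.
have ae1 : \forall x \ae mu, D x -> -1 = 1 * Num.sg `|p x|.
  apply: (@extremal_sgr_ae 1 (cst (-1))) => //.
  - by apply: aeW => x _; rewrite normrN1.
  - by exists M => x; rewrite normr_id.
  - by apply: (ae_circS p0) => x _; rewrite normr_eq0.
  - under [in RHS]eq_Rintegral do rewrite normr_id.
    by rewrite RintegralZl// -n0 !mulr0.
have [x _ [/eqP]] := ae_circ_ex (ae_circS2 ae1 p0 (fun x _ p q => conj p q)).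
move=> /[swap] px; rewrite mul1r gtr0_sg ?normr_gt0//.
by rewrite lt_eqF// ltrNl ltrN10.
Qed.

End CircleIntegral.

(** * Duality between a linear form and the L^1 norm on a finite-dimensional span *)

Section L1Duality.
Variables (R : realType) (m : nat) (phi : 'I_m.+1 -> R -> R).
Local Notation mu := (@lebesgue_measure R).
Local Notation D := (@circD R).
Local Hint Extern 0 (measurable _) => exact: measurable_circD : core.
Hypothesis phi_cont : forall k, continuous (phi k).
Hypothesis phi_le1 : forall k x, `|phi k x| <= 1.

Let comb (w : 'rV[R]_m.+1) (x : R) : R := \sum_k w 0 k * phi k x.
Let M : R := m.+1%:R.
Let nrm1 (w : 'rV[R]_m.+1) : R := \int[mu]_(x in D) `|comb w x|.

Let M_gt0 : 0 < M. Proof. by rewrite ltr0n. Qed.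

Let combD v w x : comb (v + w) x = comb v x + comb w x.
Proof. by rewrite -big_split; apply: eq_bigr => k _; rewrite mxE mulrDl. Qed.

Let combZ a w x : comb (a *: w) x = a * comb w x.
Proof. by rewrite mulr_sumr; apply: eq_bigr => k _; rewrite mxE mulrA. Qed.

Let combB v w x : comb (v - w) x = comb v x - comb w x.
Proof. by rewrite combD -scaleN1r combZ mulN1r. Qed.

Let coord_le (w : 'rV[R]_m.+1) k : `|w 0 k| <= `|w|.
Proof.
rewrite [leRHS]/Num.norm/= mx_normrE.
exact: (le_bigmax _ (fun ij : 'I_1 * 'I_m.+1 => `|w ij.1 ij.2|) (0, k)).
Qed.

Let comb_le w x : `|comb w x| <= M * `|w|.
Proof.
apply: (le_trans (ler_norm_sum _ _ _)).
rewrite (_ : M * `|w| = \sum_(k < m.+1) `|w|); last first.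
  by rewrite sumr_const card_ord mulr_natl.
by apply: ler_sum => k _; rewrite normrM -[leRHS]mulr1 ler_pM.
Qed.

Let measurable_phi k : measurable_fun D (phi k).
Proof. by apply: measurable_funTS; apply: continuous_measurable_fun. Qed.

Let measurable_comb w : measurable_fun D (comb w).
Proof. by apply: measurable_sum => k; apply: measurable_funM. Qed.

Let integrable_norm_comb w : mu.-integrable D (EFin \o (fun x => `|comb w x|)).
Proof.
apply: (@bounded_integrable _ _ (M * `|w|)); first exact: measurableT_comp.
by move=> x; rewrite normr_id.
Qed.

Hint Resolve integrable_norm_comb : core.
Let nrm1_le w : nrm1 w <= M * (pi *+ 2) * `|w|.
Proof.
have -> : M * (pi *+ 2) * `|w| = \int[mu]_(x in D) (M * `|w|).
  by rewrite mulrAC Rintegral_circ_cst.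
apply: le_Rintegral => //.
by apply: (bounded_integrable (f := cst (M * `|w|)) (M := `|M * `|w| |)).
Qed.

Let nrm1_lip v w : `|nrm1 v - nrm1 w| <= M * (pi *+ 2) * `|v - w|.
Proof.
apply: le_trans (nrm1_le _); rewrite /nrm1 -RintegralB//.
have iB : mu.-integrable D (EFin \o (fun x => `|comb v x| - `|comb w x|)).
  have h := @integrableB _ _ R mu D (@measurable_circD R) _ _ (integrable_norm_comb v) (integrable_norm_comb w).
  by apply: eq_integrable h => // x _; rewrite /= EFinB.
apply: le_trans; first by apply: le_normr_Rintegral iB.
apply: le_Rintegral => //.
  by apply: integrable_norm.
by move=> x _; rewrite combB; exact: ler_dist_dist.
Qed.

Let nrm1_cont : continuous nrm1.
Proof.
move=> v; apply/(cvgrPdist_lt (FF := nbhs_filter v)) => e e0.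
have K0 : 0 < M * (pi *+ 2) by rewrite mulr_gt0 ?pi2_gt0.
have d0 : 0 < (M * (pi *+ 2))^-1 * e by rewrite mulr_gt0 ?invr_gt0.
have := nbhsx_ballx v _ d0; apply: (filterS (Filter := nbhs_filter v)) => w.
rewrite -ball_normE /ball_/= ltr_pdivlMl//.
exact: le_lt_trans (nrm1_lip _ _).
Qed.

Variable b : 'I_m.+1 -> R.
Let L (w : 'rV[R]_m.+1) : R := \sum_k w 0 k * b k.

Let LD v w : L (v + w) = L v + L w.
Proof. by rewrite -big_split; apply: eq_bigr => k _; rewrite mxE mulrDl. Qed.

Let LZ a w : L (a *: w) = a * L w.
Proof. by rewrite mulr_sumr; apply: eq_bigr => k _; rewrite mxE mulrA. Qed.

Let L_cont : continuous L.
Proof.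
rewrite /L; elim: (index_enum _) => [|k s ih].
  by under eq_fun do rewrite big_nil; exact: cst_continuous.
under eq_fun do rewrite big_cons; move=> v.
apply: (cvgD (FF := nbhs_filter v)); last exact: ih.
apply: (cvgM (FF := nbhs_filter v)); first exact: coord_continuous.
exact: cst_continuous.
Qed.

(** A strong form of linear independence. It makes [nrm1] positive away from 0, and it lets the
    signs of small perturbations of [comb w] converge a.e. to the sign of [comb w]. *)
Hypothesis comb_ae_neq0 : forall w : 'rV[R]_m.+1, w != 0 ->
  \forall x \ae mu, D x -> \sum_k w 0 k * phi k x != 0.

Let nrm1Z a w : nrm1 (a *: w) = `|a| * nrm1 w.
Proof.
rewrite -RintegralZl//.
by apply: eq_Rintegral => x _; rewrite combZ normrM.
Qed.

Let nrm1_gt0 w : w != 0 -> 0 < nrm1 w.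
Proof.
move=> w0; apply: Rintegral_norm_gt0 => //; last exact: comb_ae_neq0.
by exists (M * `|w|).
Qed.

(** The quotient [L w / nrm1 w] is continuous on the compact unit sphere of the coefficient norm; c
    is its maximum, and homogeneity carries the bound from the sphere to all vectors. *)
Let dual_extremal : exists w c, [/\ w != 0, 0 <= c, L w = c * nrm1 w & forall v, L v <= c * nrm1 v].
Proof.
pose A := [set w : 'rV[R]_m.+1 | `|w| = 1].
have A_neq0 w : A w -> w != 0.
  by rewrite /A/= => h; rewrite -normr_eq0 h oner_eq0.
have cA : compact A.
  apply: bounded_closed_compact.
    by exists 1; split=> // x x1 w; rewrite /A/= => ->; exact: ltW.
  apply: (@closed_comp _ _ (fun w : 'rV[R]_m.+1 => `|w|) [set 1]).
    by move=> w _; exact: norm_continuous.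
  exact: closed_eq.
have A0 : A !=set0.
  pose u : 'rV[R]_m.+1 := const_mx 1.
  have u0 : `|u| != 0.
    rewrite normr_eq0; apply/eqP => /rowP/(_ 0); rewrite !mxE; apply/eqP.
    exact: oner_neq0.
  by exists (`|u|^-1 *: u); rewrite /A/= normrZ ger0_norm ?invr_ge0// mulVf.
have [|w] := EVT_max_rV (f := fun w => L w / nrm1 w) A0 cA.
  apply: continuous_in_subspaceT => w /set_mem/A_neq0 w0.
  apply: (cvgM (FF := nbhs_filter w)); first exact: L_cont.
  apply: (cvgV (FF := nbhs_filter w)); last exact: nrm1_cont.
  by rewrite gt_eqF ?nrm1_gt0.
rewrite inE => Aw wmax; have w0 := A_neq0 _ Aw; have nw := nrm1_gt0 w0.
exists w, (L w / nrm1 w); split => //.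
(* The antipode -w has the opposite quotient, so a negative value could not be maximal. *)
- have : - w \in A by rewrite inE /A/= normrN.
  move/wmax; rewrite -scaleN1r LZ nrm1Z normrN1 mul1r mulN1r mulNr.
  by rewrite lerNl -subr_ge0 opprK -mulr2n pmulrn_lge0.
- by rewrite divfK ?gt_eqF.
- move=> v; have [->|v0] := eqVneq v 0.
    by rewrite -(scale0r 0) LZ nrm1Z normr0 !mul0r mulr0.
  have nv : 0 < `|v| by rewrite normr_gt0.
  have : `|v|^-1 *: v \in A.
    by rewrite inE /A/= normrZ ger0_norm ?invr_ge0// mulVf ?gt_eqF.
  move/wmax; rewrite LZ nrm1Z ger0_norm ?invr_ge0// -mulf_div divff ?invr_eq0 ?gt_eqF//.
  by rewrite mul1r ler_pdivrMr ?nrm1_gt0.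
Qed.

Let integrable_sgr_comb (v w : 'rV[R]_m.+1) :
  mu.-integrable D (EFin \o (fun x => Num.sg (comb v x) * comb w x)).
Proof.
apply: (@bounded_integrable _ _ (M * `|w|)).
  by apply: measurable_funM => //; exact: measurable_fun_sgr.
move=> x; rewrite normrM normr_sg; apply: le_trans (comb_le w x).
by rewrite -[leRHS]mul1r ler_wpM2r// lern1 leq_b1.
Qed.

(** Convexity of the absolute value: if y is the value of the perturbed combination, then |y| - |v|
    <= sgn(y) (y - v) = t sgn(y) q pointwise. The sign is taken at the perturbed point so that the
    estimate is an upper bound. *)
Let nrm1_incr (v q : 'rV[R]_m.+1) (t : R) : 0 < t ->
  nrm1 (v + t *: q) - nrm1 v <=
  t * \int[mu]_(x in D) (Num.sg (comb (v + t *: q) x) * comb q x).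
Proof.
move=> t0; rewrite /nrm1 -RintegralZl// -RintegralB//.
apply: le_Rintegral => //.
- have h := @integrableB _ _ R mu D (@measurable_circD R) _ _
    (integrable_norm_comb (v + t *: q)) (integrable_norm_comb v).
  by apply: eq_integrable h => // x _; rewrite /= EFinB.
- have h := @integrableZl _ _ R mu D (@measurable_circD R) t _ (integrable_sgr_comb (v + t *: q) q).
  by apply: eq_integrable h => // x _; rewrite /= EFinM.
move=> x _; set y := comb (v + t *: q) x.
have -> : t * (Num.sg y * comb q x) = Num.sg y * y - Num.sg y * comb v x.
  by rewrite /y combD combZ; ring.
rewrite -normrEsg lerB// (le_trans (ler_norm _))// normrM normr_sg.
by rewrite -[leRHS]mul1r ler_wpM2r// lern1 leq_b1.
Qed.

(** Extremality at w gives t L(q) = L(w + t q) - L(w) <= c (nrm1(w + t q) - nrm1(w)). After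
    [nrm1_incr] and division by t, dominated convergence along t = 1/(n+1) replaces the perturbed
    sign by that of [comb w]. *)
Let sgr_moment_ge w c q : w != 0 -> 0 <= c -> L w = c * nrm1 w ->
  (forall v, L v <= c * nrm1 v) ->
  L q <= c * \int[mu]_(x in D) (Num.sg (comb w x) * comb q x).
Proof.
move=> w0 c0 Lw Lle.
pose t n : R := n.+1%:R^-1.
have t0 n : 0 < t n by rewrite invr_gt0 ltr0n.
pose F n x := Num.sg (comb (w + t n *: q) x) * comb q x.
have leF n : L q <= c * \int[mu]_(x in D) F n x.
  rewrite -(ler_pM2l (t0 n)) -LZ mulrCA.
  apply: le_trans (ler_wpM2l c0 (nrm1_incr w q (t0 n))).
  by rewrite mulrBr -Lw lerBrDl -LD.
have mF n : measurable_fun D (EFin \o F n).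
  by apply/measurable_EFinP; apply: measurable_funM => //; exact: measurable_fun_sgr.
pose F0 x := Num.sg (comb w x) * comb q x.
have mF0 : measurable_fun D (EFin \o F0).
  by apply/measurable_EFinP; apply: measurable_funM => //; exact: measurable_fun_sgr.
have Fcvg : \forall x \ae mu, D x -> (EFin \o F n) x @[n --> \oo] --> (EFin \o F0) x.
  apply: (ae_circS (comb_ae_neq0 w0)) => x _; rewrite -/(comb w x) => wx.
  apply: cvg_EFin; first exact: nearW.
  apply: cvg_near_cst.
  (* Below this threshold for t, the term t q is smaller than [comb w] at x and the sign no longer
     changes. The summand 1 keeps the denominator positive where [comb q] vanishes. *)
  have e0 : 0 < `|comb w x| / (`|comb q x| + 1).
    by rewrite divr_gt0 ?normr_gt0// ltr_wpDl.
  near=> n; rewrite /= /F /F0 combD combZ sgrD_small// normrM gtr0_norm//.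
  apply: (@le_lt_trans _ _ (t n * (`|comb q x| + 1))).
    by rewrite ler_wpM2l ?lerDl// ltW.
  rewrite -ltr_pdivlMr ?ltr_wpDl//.
  by near: n; exact: (near_infty_natSinv_lt (PosNum e0)).
have ig : mu.-integrable D (EFin \o cst (M * `|q|)).
  by apply: (bounded_integrable (M := `|M * `|q| |)).
have Fg : \forall x \ae mu, forall n, D x -> (`|(F n x)%:E| <= (EFin \o cst (M * `|q|)%R) x)%E.
  apply: aeW => x n _; rewrite /= lee_fin normrM normr_sg.
  apply: le_trans (comb_le q x).
  by rewrite -[leRHS]mul1r ler_wpM2r// lern1 leq_b1.
have [iF0 _ cF] := @dominated_convergence _ _ R mu D (@measurable_circD R)
  (fun n => EFin \o F n) (EFin \o F0) _ mF mF0 Fcvg ig Fg.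
have {}cF : \int[mu]_(x in D) F n x @[n --> \oo] --> \int[mu]_(x in D) F0 x.
  apply: fine_cvg; rewrite fineK; first exact: cF.
  exact: (@integrable_fin_num _ _ R mu D).
have cF' : c * \int[mu]_(x in D) F n x @[n --> \oo] --> c * \int[mu]_(x in D) F0 x.
  exact: cvgMl_tmp.
apply: (cvgr_to_ge cF'); exact: nearW.
Unshelve. all: by end_near. Qed.

(** The one-sided bound [sgr_moment_ge], applied to a coordinate vector and to its negative, becomes
    an equality. *)
Theorem L1_dual_extremal : exists (w : 'rV[R]_m.+1) (c : R),
  [/\ w != 0, 0 <= c & forall k,
   \int[mu]_(x in D) (c * Num.sg (\sum_j w 0 j * phi j x) * phi k x) = b k].
Proof.
have [w [c [w0 c0 Lw Lle]]] := dual_extremal.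
exists w, c; split=> // k; pose e : 'rV[R]_m.+1 := delta_mx 0 k.
have combe x : comb e x = phi k x.
  rewrite /comb (bigD1 k)//= big1 ?addr0 ?mxE ?eqxx ?mul1r// => j jk.
  by rewrite mxE/= (negbTE jk) mul0r.
have Le : L e = b k.
  rewrite /L (bigD1 k)//= big1 ?addr0 ?mxE ?eqxx ?mul1r// => j jk.
  by rewrite mxE/= (negbTE jk) mul0r.
have E : \int[mu]_(x in D) (c * Num.sg (\sum_j w 0 j * phi j x) * phi k x) =
    c * \int[mu]_(x in D) (Num.sg (comb w x) * comb e x).
  by rewrite -RintegralZl//; apply: eq_Rintegral => x _; rewrite combe mulrA.
rewrite E -Le; apply/eqP; rewrite eq_le sgr_moment_ge// andbT.
have := sgr_moment_ge (- e) w0 c0 Lw Lle.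
rewrite -scaleN1r LZ mulN1r.
under eq_Rintegral do rewrite combZ mulrCA.
by rewrite RintegralZl// mulrCA mulN1r lerN2.
Qed.

End L1Duality.

(** * Sign changes of a continuous function with finitely many zeros *)

Section SignPattern.
Variables (R : realType) (p : R -> R).
Hypothesis p_cont : continuous p.

Lemma opposite_signs_root (a b : R) : a < b -> p a * p b < 0 ->
  exists2 z, a < z < b & p z = 0.
Proof.
move=> ab pab.
have [||z] := IVT (f := p) (a := a) (b := b) (v := 0) (ltW ab).
- exact: continuous_subspaceT.
- rewrite ge_min le_max; move: pab.
  case: (ltgtP (p a) 0) => [a0|a0|->]; last by rewrite mul0r ltxx.
    by rewrite nmulr_rlt0// => /ltW ->.
  by rewrite pmulr_rlt0// => /ltW ->.
rewrite in_itv/= => /andP[az zb] pz; exists z => //.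
rewrite !lt_neqAle az zb !andbT; apply/andP; split; apply/eqP => e.
  by move: pab; rewrite e pz mul0r ltxx.
by move: pab; rewrite -e pz mulr0 ltxx.
Qed.

(** A sign different from the one at the midpoint would force a zero strictly between. That zero is
    interior even when x is an endpoint, so endpoints where p does not vanish are covered. *)
Lemma sgr_constant (a b : R) : a < b -> (forall x, a < x < b -> p x != 0) ->
  exists2 e : R, e = 1 \/ e = -1 &
    forall x, a <= x <= b -> p x != 0 -> Num.sg (p x) = e.
Proof.
move=> ab pn0; pose m := (a + b) / 2.
have amb : a < m < b by rewrite /m; apply/andP; split; lra.
have pm := pn0 _ amb.
exists (Num.sg (p m)); first by move: pm; case: (ltgtP (p m) 0) => [/ltr0_sg ->|/gtr0_sg ->|] // _; [right|left].
move=> x /andP[ax xb] px; apply: contrapT => /eqP sne.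
have neg : p x * p m < 0.
  move: sne px pm; case: (ltgtP (p x) 0) => // hx; case: (ltgtP (p m) 0) => // hm;
    rewrite ?(ltr0_sg hx) ?(gtr0_sg hx) ?(ltr0_sg hm) ?(gtr0_sg hm) ?eqxx// => _ _ _.
    by rewrite nmulr_rlt0.
  by rewrite pmulr_rlt0.
have [am mb] := andP amb.
have [xm|mx|e] := ltgtP x m.
- have [z /andP[xz zm] /eqP] := opposite_signs_root xm neg.
  by apply/negP/pn0; rewrite (le_lt_trans ax xz) (lt_trans zm mb).
- rewrite mulrC in neg; have [z /andP[mz zx] /eqP] := opposite_signs_root mx neg.
  by apply/negP/pn0; rewrite (lt_trans am mz) (lt_le_trans zx xb).
- by move: sne; rewrite e eqxx.
Qed.

(** Here s lists all interior zeros, and t keeps those at which the sign changes. Induction on s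
    compares the sign just before its first zero with the initial sign after it. *)
Lemma sgr_alternates (s : seq R) (a b : R) : a < b -> path <%R a s -> all (< b) s ->
  (forall x, a < x < b -> (p x == 0) = (x \in s)) ->
  exists (t : seq R) (e : R), [/\ subseq t s, e = 1 \/ e = -1 &
    forall x, a <= x <= b -> p x != 0 ->
      Num.sg (p x) = e * (-1) ^+ count (<= x) t].
Proof.
elim: s a => [|z s ih] a ab /=.
  move=> _ _ pz; have [|e e1 he] := sgr_constant ab.
    by move=> x /pz ->.
  by exists [::], e; split=> // x xab px; rewrite expr0 mulr1 he.
move=> /andP[az zs] /andP[zb sb] pz.
have z_lt y : y \in s -> z < y.
  by move: (order_path_min lt_trans zs) => /allP; exact.
have pz0 : p z = 0 by apply/eqP; rewrite pz ?az// inE eqxx.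
have [|e0 e01 he0] := sgr_constant az.
  move=> x /andP[ax xz]; rewrite pz ?ax ?(lt_trans xz)// inE lt_eqF//=.
  by apply/negP => /z_lt; rewrite ltNge ltW.
have [|t [e [ts e1 he]]] := ih z zb zs sb.
  move=> x /andP[zx xb]; rewrite pz ?xb ?(lt_trans az)// inE.
  by rewrite gt_eqF.
have t_lt y : y \in t -> z < y by move/(mem_subseq ts)/z_lt.
have cnt0 x : x < z -> count (<= x) t = 0%N.
  move=> xz; apply/eqP; rewrite -leqn0 leqNgt -has_count; apply/hasPn => y /t_lt zy.
  by rewrite -ltNge (lt_trans xz).
have split_x x : a <= x <= b -> p x != 0 -> (x < z) || (z < x).
  move=> _ px; rewrite -neq_lt; apply/eqP => e'; move: px.
  by rewrite e' pz0 eqxx.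
(* Equal signs on both sides of z: p touches 0 without crossing, and z is dropped. *)
have [ee|ee] := eqVneq e0 e.
  exists t, e; split => //; first exact: subseq_trans ts (subseq_cons _ _).
  move=> x xab px; have [ax xb] := andP xab.
  have [xz|zx] := orP (split_x x xab px).
    by rewrite cnt0// expr0 mulr1 -ee he0// ax ltW.
  by rewrite he// ltW.
(* The signs differ, so e = - e0, and the extra factor -1 comes from counting z. *)
exists (z :: t), e0; split => //; first by rewrite /= eqxx.
move=> x xab px; have [ax xb] := andP xab.
have [xz|zx] := orP (split_x x xab px).
  by rewrite /= cnt0// leNgt xz /= expr0 mulr1 he0// ax ltW.
rewrite he ?(ltW zx)//= (ltW zx) add1n exprS mulrA; congr (_ * _).
by case: e01 e1 ee => -> [] ->; rewrite ?eqxx//; move=> _; ring.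
Qed.

End SignPattern.

(** A duplicate-free list of maximal length must exhaust P, since a missing point would extend it. A
    bound on the number of zeros thus becomes a list of all of them. *)
Lemma bounded_subset_seq (T : choiceType) (P : T -> Prop) (M : nat) :
  (forall s : seq T, uniq s -> (forall x, x \in s -> P x) -> (size s <= M)%N) ->
  exists2 s : seq T, uniq s & forall x, P x <-> x \in s.
Proof.
move=> bnd.
pose Q n := `[< exists s : seq T, [/\ uniq s, forall x, x \in s -> P x & size s = n] >].
have Q0 : exists n, Q n by exists 0%N; apply/asboolP; exists [::].
have QM n : Q n -> (n <= M)%N.
  by move=> /asboolP[s [us sP <-]]; exact: bnd.
have [n /asboolP[s [us sP sn]] nmax] := ex_maxnP Q0 QM.
exists s => // x; split; last exact: sP.
move=> Px; apply: contrapT => /negP xs.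
suff /nmax : Q n.+1 by rewrite ltnn.
apply/asboolP; exists (x :: s); split; rewrite /= ?xs ?sn//.
by move=> y; rewrite inE => /predU1P[->|/sP].
Qed.

(** Converts the count of breakpoints below x into the index of the arc containing x. The guard on
    the upper bound lets the last index stand for the unbounded final interval. *)
Lemma count_le_sorted (R : realDomainType) (t : seq R) (x : R) (i : nat) :
  sorted <%R t -> (i < size t)%N -> t`_i <= x ->
  ((i.+1 < size t)%N -> x < t`_i.+1) -> count (<= x) t = i.+1.
Proof.
elim: t i => [//|y t ih] [|i] /= yt it tx xt.
  rewrite tx add1n; congr _.+1; apply/eqP; rewrite -leqn0 leqNgt -has_count.
  case: t yt xt {ih it} => [//|z t] /= /andP[_ zt] /(_ isT) xz.
  rewrite negb_or -ltNge xz /=; apply/hasPn => u ut; rewrite -ltNge (lt_trans xz)//.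
  by move: (order_path_min lt_trans zt) => /allP; exact.
rewrite (ih i)//; last exact: path_sorted yt.
rewrite (le_trans _ tx)// ltW//.
by move: (order_path_min lt_trans yt) => /allP; apply; exact: mem_nth.
Qed.

(** * Sign patterns on the circle and the parity of the number of sign changes *)

Section PeriodicSignPattern.
Variables (R : realType) (p : R -> R) (N : nat).
Local Notation D := (@circD R).
Hypothesis p_cont : continuous p.
Hypothesis p_period : p (pi *+ 2) = p 0.
Hypothesis p_roots : forall s : seq R, uniq s ->
  (forall x, x \in s -> D x /\ p x = 0) -> (size s <= N.*2)%N.

(** The arc structure of [alt_step], stated for the sign of q off its zeros instead of almost
    everywhere, and independent of a height. *)
Definition alt_pattern (n : nat) (q : R -> R) : Prop :=
  (0 < n)%N /\ exists (t : nat -> R) (s : R),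
    [/\ s = 1 \/ s = -1, 0 <= t 0%N,
        forall i : nat, (i < (n.*2).-1)%N -> t i < t i.+1,
        t (n.*2).-1 < pi *+ 2 &
        forall x, D x -> q x != 0 ->
          (forall i : nat, (i < (n.*2).-1)%N -> t i <= x < t i.+1 ->
             Num.sg (q x) = s * (-1) ^+ i) /\
          (x < t 0%N \/ t (n.*2).-1 <= x -> Num.sg (q x) = - s)].

Lemma alt_pattern_of_seq (n : nat) (t : seq R) (e : R) :
  (0 < n)%N -> size t = n.*2 -> sorted <%R t -> e = 1 \/ e = -1 ->
  (forall x, x \in t -> D x) ->
  (forall x, D x -> p x != 0 -> Num.sg (p x) = e * (-1) ^+ count (<= x) t) ->
  alt_pattern n p.
Proof.
move=> n0 st sort_t e1 tD ht; split=> //.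
have n2 : (0 < n.*2)%N by rewrite double_gt0.
(* On the arc starting at the breakpoint of index i the count is i + 1, so the arc of index 0
   carries the sign - e. *)
exists (fun i => t`_i), (- e); split.
- by case: e1 => ->; [right|left; rewrite opprK].
- have /= := tD t`_0 (mem_nth _ _); rewrite st => /(_ n2).
  by rewrite /circD/= in_itv/= => /andP[].
- move=> i ilt; rewrite -[t`_i < _]/(<%R t`_i t`_i.+1).
  apply: (sorted_ltn_nth lt_trans) => //; rewrite inE st.
    by rewrite (leq_trans ilt)// leq_pred.
  by rewrite -ltn_predRL.
- have /= := tD t`_(n.*2).-1 (mem_nth _ _); rewrite st prednK// leqnn => /(_ isT).
  by rewrite /circD/= in_itv/= => /andP[].
move=> x Dx px; split=> [i ilt /andP[tix xti]|].
  rewrite (ht x Dx px) (@count_le_sorted _ _ _ i)//; last 1 first.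
  - by rewrite st (leq_trans ilt)// leq_pred.
  by rewrite exprS mulN1r mulrN mulNr.
rewrite opprK (ht x Dx px) => -[xt|tx].
  suff -> : count (<= x) t = 0%N by rewrite expr0 mulr1.
  case: t st sort_t xt {ht tD} => [|y t] /=; first by move=> h; rewrite -h in n2.
  move=> _ yt xy; rewrite leNgt xy add0n.
  apply/eqP; rewrite -leqn0 leqNgt -has_count; apply/hasPn => u ut.
  by rewrite -ltNge (lt_trans xy)//; move: (order_path_min lt_trans yt) => /allP; apply.
(* Past the last breakpoint the count is 2n, which is even: the sign is e again, as before the first
   breakpoint, so the two pieces form one arc. *)
rewrite (@count_le_sorted _ _ _ (n.*2).-1)// ?st ?prednK ?ltnn//.
by rewrite -signr_odd odd_double expr0 mulr1.
Qed.

(** The interior sign changes serve as breakpoints when their number is even. When it is odd, the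
    remaining sign change sits at the point 0. All breakpoints are zeros, which gives the bound on
    n. *)
Lemma periodic_sign_pattern : exists n : nat, (n <= N)%N /\
  ((n = 0%N /\ exists2 e : R, e = 1 \/ e = -1 &
      forall x, D x -> p x != 0 -> Num.sg (p x) = e) \/ alt_pattern n p).
Proof.
have D_oo (x : R) : 0 < x < pi *+ 2 -> D x.
  by move=> /andP[x0 x2]; rewrite /circD/= in_itv/= x2 ltW.
have [|z uz Pz] := @bounded_subset_seq R (fun x => 0 < x < pi *+ 2 /\ p x = 0) N.*2.
  by move=> s us sP; apply: p_roots => // x /sP[/D_oo].
pose s := sort <=%R z.
have sz x : (x \in s) = (x \in z) by rewrite mem_sort.
have ss : sorted <%R s by rewrite sort_lt_sorted.
have s_oo x : x \in s -> 0 < x < pi *+ 2 by rewrite sz => /Pz[].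
have path_s : path <%R 0 s.
  case: s ss s_oo {sz} => [//|y s] /= ys h; rewrite ys andbT.
  by have /andP[] := h y (mem_head _ _).
have all_s : all (< (pi *+ 2)) s by apply/allP => x /s_oo/andP[].
have zero_s x : 0 < x < pi *+ 2 -> (p x == 0) = (x \in s).
  move=> x02; rewrite sz; apply/eqP/idP => [px|/Pz[]//].
  by apply/Pz.
have [t [e [ts e1 ht]]] := sgr_alternates p_cont (pi2_gt0 R) path_s all_s zero_s.
have sort_t : sorted <%R t by exact: (subseq_sorted lt_trans ts ss).
have t_oo x : x \in t -> 0 < x < pi *+ 2 by move/(mem_subseq ts)/s_oo.
have t0 x : x \in t -> p x = 0.
  by move=> xt; have := mem_subseq ts xt; rewrite sz => /Pz[].
have D_cc (x : R) : D x -> 0 <= x <= pi *+ 2.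
  by rewrite /circD/= in_itv/= => /andP[-> /ltW].
have cnt0 : count (<= 0) t = 0%N.
  apply/eqP; rewrite -leqn0 leqNgt -has_count; apply/hasPn => x /t_oo/andP[x0 _].
  by rewrite -ltNge.
have cnt2 : count (<= (pi *+ 2)) t = size t.
  by apply/eqP; rewrite -all_count; apply/allP => x /t_oo/andP[_ /ltW].
have ut : uniq t by exact: sorted_uniq lt_trans ltxx _ sort_t.
have tN : (size t <= N.*2)%N.
  by apply: p_roots => // x xt; split; [exact/D_oo/t_oo|exact: t0].
have pi2ge : 0 <= (pi *+ 2 : R) by rewrite ltW ?pi2_gt0.
have [odd_t|even_t] := boolP (odd (size t)).
(* Otherwise an odd number of sign changes would give p opposite signs at 0 and at 2 pi, against
   periodicity. *)
- have p0 : p 0 = 0.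
    apply: contrapT => /eqP p0.
    have := ht 0; rewrite lexx pi2ge p0 cnt0 expr0 mulr1 => /(_ isT isT) h0.
    have := ht (pi *+ 2); rewrite lexx pi2ge p_period p0 cnt2 -signr_odd odd_t expr1.
    move=> /(_ isT isT); rewrite h0; case: e1 => ->; lra.
  (* The point 0 is a zero of p outside t, so adding it to the breakpoints respects the bound 2N. *)
  have t1N : ((size t).+1 <= N.*2)%N.
    apply: (p_roots (s := 0 :: t)); rewrite /= ?ut ?andbT.
      by apply/negP => /t_oo; rewrite ltxx.
    move=> x; rewrite inE => /predU1P[->|xt].
      by split=> //; rewrite /circD/= in_itv/= lexx pi2_gt0.
    by split; [exact/D_oo/t_oo|exact: t0].
  have st1 : size (0 :: t) = (size t).+1./2.*2 by rewrite even_halfK//= odd_t.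
  exists (size t).+1./2; split; first by rewrite -leq_double -st1.
  (* The new breakpoint 0 is counted at every point of the circle; passing from e to - e compensates
     for it. *)
  right; apply: (@alt_pattern_of_seq _ (0 :: t) (- e)) => //.
  + by rewrite half_gt0; case: (size t) odd_t.
  + rewrite /= path_min_sorted//; apply/allP => x /t_oo/andP[//].
  + by case: e1 => ->; [right|left; rewrite opprK].
  + move=> x; rewrite inE => /predU1P[->|xt]; last exact/D_oo/t_oo.
    by rewrite /circD/= in_itv/= lexx pi2_gt0.
  + move=> x Dx px; have := D_cc _ Dx => x02; rewrite ht//=.
    by have /andP[-> _] := x02; rewrite add1n exprS mulN1r mulrNN.
have st : size t = (size t)./2.*2 by rewrite even_halfK.
exists (size t)./2; split; first by rewrite -leq_double -st.
have [t00|tn0] := eqVneq (size t)./2 0%N.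
  left; split=> //; exists e => // x Dx px; rewrite ht//; last exact: D_cc.
  have t_nil : t = [::] by apply/nilP; rewrite /nilp st t00.
  by rewrite t_nil expr0 mulr1.
right; apply: (@alt_pattern_of_seq _ t e) => //; first by rewrite lt0n.
  by move=> x /t_oo/D_oo.
by move=> x Dx px; rewrite ht//; exact: D_cc.
Qed.

End PeriodicSignPattern.

(** * Real trigonometric polynomials and the number of their zeros *)

Section TrigonometricPolynomials.
Variable R : realType.
Local Notation D := (@circD R).

Definition expi (x : R) : R[i] := cos x +i* sin x.

Lemma expiD (x y : R) : expi (x + y) = expi x * expi y.
Proof. by rewrite /expi cosD sinD; simpc; congr (_ +i* _); ring. Qed.

Lemma expiMn (x : R) (n : nat) : expi (n%:R * x) = expi x ^+ n.
Proof.
elim: n => [|n ih]; first by rewrite mul0r expr0 /expi cos0 sin0.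
by rewrite -natr1 mulrDl mul1r expiD ih exprSr.
Qed.

(** The difference d lies in [0, 2 pi[ with sin d = 0 and cos d = 1. The sine is nonzero on the open
    half-circles and cos pi = -1, which leaves d = 0. *)
Lemma expi_inj (x y : R) : D x -> D y -> expi x = expi y -> x = y.
Proof.
rewrite /circD/= !in_itv/=.
wlog xy : x y / x <= y => [wl Dx Dy e|].
  by case: (leP x y) => [/wl|/ltW /wl h]; [exact|apply/esym/h].
move=> /andP[x0 _] /andP[_ y2] [ec es].
pose d := y - x; have sd : sin d = 0 by rewrite /d sinB ec es; ring.
have cd : cos d = 1 by rewrite /d cosB ec es -(cos2Dsin2 y); ring.
have d0 : 0 <= d by rewrite subr_ge0.
have d2 : d < pi *+ 2 by rewrite /d; lra.
have [d_le|d_gt] := leP d 0; first by rewrite /d in d_le; lra.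
have [d_lt|pi_lt|e] := ltgtP d pi.
- by have := @sin_gt0_pi _ d; rewrite d_gt d_lt sd ltxx => /(_ isT).
- have := @sin_gt0_pi _ (d - pi); rewrite subr_gt0 pi_lt sinB sd cospi sinpi mulr0 mul0r subr0 ltxx.
  have -> : d - pi < pi by rewrite mulr2n in d2; lra.
  by move=> /(_ isT).
- by move: cd; rewrite e cospi; lra.
Qed.

Variable N : nat.

(* Indices [k <= N] encode cosines and indices [N + j] sines, so that each real trigonometric
   polynomial of degree at most [N] has a unique coefficient vector. *)
Definition trig (k : 'I_N.*2.+1) (x : R) : R :=
  if (k <= N)%N then cos (k%:R * x) else sin ((k - N)%:R * x).

Lemma trig_le1 k x : `|trig k x| <= 1.
Proof. by rewrite /trig; case: ifP => _; rewrite ?cos_max ?sin_max. Qed.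

Lemma trig_continuous k : continuous (trig k).
Proof.
have cM (a : R) : continuous ( *%R a) by move=> x; apply: cvgMl_tmp; exact: cvg_id.
have -> : trig k = if (k <= N)%N then cos \o *%R k%:R else sin \o *%R (k - N)%:R.
  by apply/funext => x; rewrite /trig; case: ifP.
case: ifP => _ x; apply: continuous_comp; try exact: cM.
- exact: continuous_cos.
- exact: continuous_sin.
Qed.

Lemma trig_period k : trig k (pi *+ 2) = trig k 0.
Proof.
have e (n : nat) : n%:R * (pi *+ 2) = 0 + (pi *+ 2) *+ n :> R by rewrite add0r mulr_natl.
by rewrite /trig !mulr0 !e; case: ifP => _;
  [exact: periodicn (@cosD2pi R) _ _|exact: periodicn (@sinD2pi R) _ _].
Qed.

(** Euler's formulas for 2 cos and 2 sin in the variable z = e^{ix}, multiplied by z^N to clear the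
    negative powers. *)
Definition trig_poly (k : 'I_N.*2.+1) : {poly R[i]} :=
  if (k <= N)%N then 'X^(N + k) + 'X^(N - k)
  else (- 'i%C) *: ('X^(N + (k - N)) - 'X^(N - (k - N))).

Lemma horner_trig_poly k x :
  (trig_poly k).[expi x] = expi x ^+ N * (2 * trig k x)%:C.
Proof.
have expiB j : (j <= N)%N -> expi x ^+ (N - j) = expi x ^+ N * expi (- (j%:R * x)).
  move=> jN; rewrite -{2}(subnK jN) exprD -mulrA -(expiMn x j) -expiD subrr.
  by rewrite /expi cos0 sin0 mulr1.
have kN : (k - N <= N)%N by rewrite leq_subLR addnn -ltnS.
rewrite /trig_poly /trig; case: ifP => hk.
  rewrite hornerD !hornerXn expiB// exprD -(expiMn x k) -mulrDr; congr (_ * _).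
  by rewrite /expi cosN sinN; simpc; congr (_ +i* _); ring.
rewrite hornerZ hornerD hornerN !hornerXn expiB// exprD -(expiMn x (k - N)) -mulrBr mulrCA; congr (_ * _).
by rewrite /expi cosN sinN; simpc; congr (_ +i* _); ring.
Qed.

Lemma size_trig_poly k : (size (trig_poly k) <= N.*2.+1)%N.
Proof.
have kN : (k - N <= N)%N by rewrite leq_subLR addnn -ltnS.
have sX j : (j <= N.*2)%N -> (size ('X^j : {poly R[i]}) <= N.*2.+1)%N by rewrite size_polyXn.
have up j : (j <= N)%N -> (N + j <= N.*2)%N by rewrite -addnn leq_add2l.
have dn j : (N - j <= N.*2)%N by rewrite (leq_trans (leq_subr _ _))// -addnn leq_addr.
rewrite /trig_poly; case: ifP => hk.
  by rewrite (leq_trans (size_polyD _ _))// geq_max !sX ?up.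
rewrite (leq_trans (size_scale_leq _ _))// (leq_trans (size_polyD _ _))//.
by rewrite size_polyN geq_max !sX ?up.
Qed.

Variable w : 'rV[R]_N.*2.+1.
Hypothesis w_neq0 : w != 0.
Let Q : {poly R[i]} := \sum_k (w 0 k)%:C *: trig_poly k.

Let horner_Q x : Q.[expi x] = expi x ^+ N * (2 * \sum_k w 0 k * trig k x)%:C.
Proof.
rewrite horner_sum mulr_sumr rmorph_sum mulr_sumr; apply: eq_bigr => k _.
by rewrite hornerZ horner_trig_poly mulrCA -rmorphM/= mulrCA.
Qed.

Let coef_Q m : Q`_m = \sum_k (w 0 k)%:C * (trig_poly k)`_m.
Proof. by rewrite coef_sum; apply: eq_bigr => k _; rewrite coefZ. Qed.

Let ReM (a : R) (z : R[i]) : complex.Re (a%:C * z) = a * complex.Re z.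
Proof. by case: z => u v; simpc. Qed.

Let ImM (a : R) (z : R[i]) : complex.Im (a%:C * z) = a * complex.Im z.
Proof. by case: z => u v; simpc. Qed.

Let Re_coef_Q m : complex.Re Q`_m = \sum_k w 0 k * complex.Re (trig_poly k)`_m.
Proof.
rewrite coef_Q (big_morph (@complex.Re R) (id1 := 0) (op1 := +%R)) => [|[a b] [c d]|]//.
by apply: eq_bigr => k _; rewrite ReM.
Qed.

Let Im_coef_Q m : complex.Im Q`_m = \sum_k w 0 k * complex.Im (trig_poly k)`_m.
Proof.
rewrite coef_Q (big_morph (@complex.Im R) (id1 := 0) (op1 := +%R)) => [|[a b] [c d]|]//.
by apply: eq_bigr => k _; rewrite ImM.
Qed.

Let natrC (n : nat) : n%:R = n%:R +i* 0 :> R[i].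
Proof. by rewrite -[n%:R +i* 0]/((n%:R : R)%:C) rmorph_nat. Qed.

Let Re_coef_trig_poly k m : complex.Re (trig_poly k)`_m =
  if (k <= N)%N then (m == N + k)%N%:R + (m == N - k)%N%:R else 0.
Proof.
rewrite /trig_poly; case: ifP => _; first by rewrite coefD !coefXn !natrC /=.
by rewrite coefZ coefB !coefXn !natrC; simpc.
Qed.

Let Im_coef_trig_poly k m : complex.Im (trig_poly k)`_m =
  if (k <= N)%N then 0 else (m == N - (k - N))%N%:R - (m == N + (k - N))%N%:R.
Proof.
rewrite /trig_poly; case: ifP => _; first by rewrite coefD !coefXn !natrC /= addr0.
by rewrite coefZ coefB !coefXn !natrC; simpc; rewrite /=; ring.
Qed.

(** Cosines contribute real coefficients and sines imaginary ones, so the two families separate. The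
    coefficient of degree N + j has as real part the weight of the cosine of frequency j, doubled
    for j = 0; for j > 0 its imaginary part is minus the weight of the sine of frequency j. *)
Let Q_neq0 : Q != 0.
Proof.
apply: contra_neq w_neq0 => Q0; apply/rowP => j; rewrite mxE.
have [jN|jN] := leqP j N.
  have := Re_coef_Q (N + j); rewrite Q0 coef0/= (bigD1 j)//= big1 => [|k kj].
    rewrite addr0 Re_coef_trig_poly jN eqxx => /esym/eqP.
    by rewrite mulf_eq0 => /orP[/eqP//|]; rewrite paddr_eq0 ?oner_eq0.
  rewrite Re_coef_trig_poly; case: ifP => kN; last by rewrite mulr0.
  rewrite eqn_add2l eq_sym (inj_eq val_inj) (negbTE kj) add0r.
  have [e|] := eqVneq (N + j)%N (N - k)%N; last by rewrite mulr0.
  suff : k = j by move/eqP; rewrite (negbTE kj).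
  by apply: val_inj => /=; lia.
have := Im_coef_Q (N + (j - N)); rewrite Q0 coef0/= (bigD1 j)//= big1 => [|k kj].
  rewrite addr0 Im_coef_trig_poly leqNgt jN/= eqxx.
  have -> : ((N + (j - N))%N == (N - (j - N))%N) = false by apply/eqP; lia.
  by rewrite sub0r mulrN1 => /esym/eqP; rewrite oppr_eq0 => /eqP.
rewrite Im_coef_trig_poly; case: ifP => kN; first by rewrite mulr0.
have -> : ((N + (j - N))%N == (N - (k - N))%N) = false by apply/eqP; lia.
have -> : ((N + (j - N))%N == (N + (k - N))%N) = false.
  by apply/eqP => e; case/eqP: kj; apply: val_inj => /=; lia.
by rewrite subr0 mulr0.
Qed.

(** Distinct zeros on the circle have distinct images under [expi], all of them roots of the nonzero
    polynomial [Q] of degree at most 2N. *)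
Lemma trig_roots (s : seq R) : uniq s ->
  (forall x, x \in s -> D x /\ \sum_k w 0 k * trig k x = 0) -> (size s <= N.*2)%N.
Proof.
move=> us sP; have := @max_poly_roots _ Q (map expi s) Q_neq0.
rewrite size_map => /(_ _ _)/leq_trans h.
rewrite -ltnS; apply: h; last 1 first.
- rewrite /Q (leq_trans (size_sum _ _ _))//; apply/bigmax_leqP => k _.
  by rewrite (leq_trans (size_scale_leq _ _))// size_trig_poly.
- apply/allP => _ /mapP[x /sP[_ px] ->].
  by rewrite rootE horner_Q px mulr0 rmorph0 mulr0.
rewrite map_inj_in_uniq// => x y /sP[Dx _] /sP[Dy _]; exact: expi_inj.
Qed.

End TrigonometricPolynomials.

(** * Essential bounds, and Fourier coefficients as real moments *)

Section FourierMoments.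
Variable R : realType.
Local Notation mu := (@lebesgue_measure R).
Local Notation D := (@circD R).

Lemma normc_real (z : R[i]) : exists2 r : R, 0 <= r & `|z| = r%:C.
Proof. by rewrite normc_def; eexists; [|reflexivity]; exact: sqrtr_ge0. Qed.

Lemma norm_Re_Im_le (z : R[i]) (r : R) : `|z| <= r%:C ->
  `|complex.Re z| <= r /\ `|complex.Im z| <= r.
Proof.
rewrite normc_def lecR => h; split; apply: le_trans h.
  by rewrite -sqrtr_sqr ler_wsqrtr// lerDl sqr_ge0.
by rewrite -sqrtr_sqr ler_wsqrtr// lerDr sqr_ge0.
Qed.

Lemma norm_real_complex (x : R) : `|x%:C| = `|x|%:C :> R[i].
Proof. by rewrite normc_def/= expr0n/= addr0 sqrtr_sqr. Qed.

Lemma ess_bound_ge0 (g : R -> R[i]) (r : R) :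
  (\forall x \ae mu, D x -> `|g x| <= r%:C) -> 0 <= r.
Proof.
move=> /ae_circ_ex[x _ h]; have := le_trans (normr_ge0 _) h.
by rewrite lecR.
Qed.

Lemma linf_norm_le (g : R -> R[i]) (r : R) :
  (\forall x \ae mu, D x -> `|g x| <= r%:C) -> linf_norm g <= r.
Proof.
move=> gr; apply: ge_inf => //; exists 0 => s; exact: ess_bound_ge0.
Qed.

(** Membership in L^oo makes the set of essential bounds nonempty, so that [inf] is a true infimum
    and not its default value. *)
Lemma ge_linf_norm (g : R -> R[i]) (c : R) : is_Linf g ->
  (forall r, (\forall x \ae mu, D x -> `|g x| <= r%:C) -> c <= r) -> c <= linf_norm g.
Proof. by move=> [_ _ [r gr]] h; apply: lb_le_inf; [exists r|exact: h]. Qed.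

(** The infimum of the essential bounds is itself one: the bounds with slack 1/(n+1) hold
    simultaneously off a countable union of null sets. *)
Lemma linf_norm_bound (g : R -> R[i]) : is_Linf g ->
  \forall x \ae mu, D x -> `|g x| <= (linf_norm g)%:C.
Proof.
move=> [_ _ [r gr]].
pose S := [set M : R | \forall x \ae mu, D x -> `|g x| <= M%:C].
have infS : has_inf S by split; [exists r|exists 0 => s; exact: ess_bound_ge0].
have hn n : \forall x \ae mu, D x -> `|g x| <= (linf_norm g + n.+1%:R^-1)%:C.
  have n0 : 0 < n.+1%:R^-1 :> R by rewrite invr_gt0.
  have [M SM Mlt] := inf_adherent n0 infS.
  apply: (ae_circS SM) => x _ h; apply: le_trans h _.
  by rewrite lecR ltW.
have := ae_foralln hn; apply: filterS.
move=> x h Dx; have [s s0 es] := normc_real (g x).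
rewrite es lecR leNgt; apply/negP => /ltr_add_invr[k].
by have := h k Dx; rewrite es lecR leNgt => /negP.
Qed.

Lemma cos_continuousM (n : R) : continuous (fun t => cos (n * t)).
Proof.
move=> x; apply: (@continuous_comp _ _ _ ( *%R n) cos); last exact: continuous_cos.
by apply: cvgMl_tmp; exact: cvg_id.
Qed.

Lemma sin_continuousM (n : R) : continuous (fun t => sin (n * t)).
Proof.
move=> x; apply: (@continuous_comp _ _ _ ( *%R n) sin); last exact: continuous_sin.
by apply: cvgMl_tmp; exact: cvg_id.
Qed.

Lemma integrable_mul_continuous (u h : R -> R) (r : R) : measurable_fun D u ->
  (\forall x \ae mu, D x -> `|u x| <= r) -> continuous h ->
  (forall x, `|h x| <= 1) ->
  mu.-integrable D (EFin \o (fun x => u x * h x)).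
Proof.
move=> mu_ ur ch h1; apply: (@ae_bounded_integrable _ _ r).
  apply: measurable_funM => //; apply: measurable_funTS.
  exact: continuous_measurable_fun.
by apply: (ae_circS ur) => x _ ux; rewrite normrM -[leRHS]mulr1 ler_pM.
Qed.

Lemma fourierE (f : R -> R[i]) (n : int) : fourier f n =
  ((pi *+ 2)^-1 * \int[mu]_(t in D) (complex.Re (f t) * cos (n%:~R * t) +
     complex.Im (f t) * sin (n%:~R * t))) +i*
  ((pi *+ 2)^-1 * \int[mu]_(t in D) (complex.Im (f t) * cos (n%:~R * t) -
     complex.Re (f t) * sin (n%:~R * t))).
Proof.
have -> : fourier f n = ((pi *+ 2)^-1)%:C *
  ((\int[mu]_(t in D) complex.Re (f t * (cos (n%:~R * t) +i* (- sin (n%:~R * t))))) +i*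
   (\int[mu]_(t in D) complex.Im (f t * (cos (n%:~R * t) +i* (- sin (n%:~R * t)))))).
  by rewrite [X in _ = _ * X]complexE.
simpc; congr (_ * _ +i* (_ * _)); apply: eq_Rintegral => t _.
  by case: (f t) => u v /=; rewrite mulrN opprK.
by case: (f t) => u v /=; rewrite mulrN addrC.
Qed.

(** The coefficients at k and -k amount to four real equations in the cosine and sine moments of Re
    g and Im g. Under conjugate symmetry the moments of Im g cancel, which allows an extremal
    problem over real functions only. *)
Lemma fourier_moments (g : R -> R[i]) (a : int -> R[i]) (k : nat) : is_Linf g ->
  complex.Re (a (- k%:Z)) = complex.Re (a k) ->
  complex.Im (a (- k%:Z)) = - complex.Im (a k) ->
  fourier g k = a k -> fourier g (- k%:Z) = a (- k%:Z) ->
  \int[mu]_(t in D) (complex.Re (g t) * cos (k%:R * t)) = pi *+ 2 * complex.Re (a k) /\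
  \int[mu]_(t in D) (complex.Re (g t) * sin (k%:R * t)) = - (pi *+ 2 * complex.Im (a k)).
Proof.
move=> [mRe mIm [r gr]] aRe aIm Ek ENk.
have bRe : \forall x \ae mu, D x -> `|complex.Re (g x)| <= r.
  by apply: (ae_circS gr) => x _ /norm_Re_Im_le[].
have bIm : \forall x \ae mu, D x -> `|complex.Im (g x)| <= r.
  by apply: (ae_circS gr) => x _ /norm_Re_Im_le[].
have iRc := integrable_mul_continuous mRe bRe (@cos_continuousM k%:R) (fun x => cos_max _).
have iRs := integrable_mul_continuous mRe bRe (@sin_continuousM k%:R) (fun x => sin_max _).
have iIc := integrable_mul_continuous mIm bIm (@cos_continuousM k%:R) (fun x => cos_max _).
have iIs := integrable_mul_continuous mIm bIm (@sin_continuousM k%:R) (fun x => sin_max _).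
have eN t : (- k%:Z)%:~R * t = - (k%:R * t) :> R by rewrite mulrNz mulNr.
have P0 : (pi *+ 2 : R) != 0 by rewrite gt_eqF ?pi2_gt0.
have mulP (x y : R) : (pi *+ 2)^-1 * x = y -> x = pi *+ 2 * y.
  by move=> <-; rewrite mulrA divff// mul1r.
have mD := @measurable_circD R.
have := congr1 (@complex.Re R) Ek; have := congr1 (@complex.Im R) Ek.
have := congr1 (@complex.Re R) ENk; have := congr1 (@complex.Im R) ENk.
rewrite !fourierE /= aRe aIm => /mulP E4 /mulP E3 /mulP E2 /mulP E1.
move: E1 E2; rewrite RintegralD// RintegralB// => E1 E2.
have {}E3 : \int[mu]_(t in D) (complex.Re (g t) * cos (k%:R * t)) -
    \int[mu]_(t in D) (complex.Im (g t) * sin (k%:R * t)) = pi *+ 2 * complex.Re (a k).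
  rewrite -E3 -RintegralB//; apply: eq_Rintegral => t _.
  by rewrite eN cosN sinN mulrN.
have {}E4 : \int[mu]_(t in D) (complex.Im (g t) * cos (k%:R * t)) +
    \int[mu]_(t in D) (complex.Re (g t) * sin (k%:R * t)) = pi *+ 2 * - complex.Im (a k).
  rewrite -E4 -RintegralD//; apply: eq_Rintegral => t _.
  by rewrite eN cosN sinN mulrN opprK.
by split; lra.
Qed.

Lemma fourier_real_of_moments (u : R -> R) (a : int -> R[i]) (k : nat) :
  measurable_fun D u -> (exists r, forall x, `|u x| <= r) ->
  complex.Re (a (- k%:Z)) = complex.Re (a k) ->
  complex.Im (a (- k%:Z)) = - complex.Im (a k) ->
  \int[mu]_(t in D) (u t * cos (k%:R * t)) = pi *+ 2 * complex.Re (a k) ->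
  \int[mu]_(t in D) (u t * sin (k%:R * t)) = - (pi *+ 2 * complex.Im (a k)) ->
  fourier (fun x => (u x)%:C) k = a k /\
  fourier (fun x => (u x)%:C) (- k%:Z) = a (- k%:Z).
Proof.
move=> mu_ [r ur] aRe aIm Ec Es.
have P0 : (pi *+ 2 : R) != 0 by rewrite gt_eqF ?pi2_gt0.
have aeu : \forall x \ae mu, D x -> `|u x| <= r by apply: aeW.
have mD := @measurable_circD R.
have is_ := integrable_mul_continuous mu_ aeu (@sin_continuousM k%:R) (fun x => sin_max _).
have eN t : (- k%:Z)%:~R * t = - (k%:R * t) :> R by rewrite mulrNz mulNr.
have sN : \int[mu]_(t in D) - (u t * sin (k%:R * t)) = pi *+ 2 * complex.Im (a k).
  rewrite -[RHS]opprK -Es -mulN1r -RintegralZl//.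
  by apply: eq_Rintegral => t _; rewrite mulN1r.
split; rewrite fourierE.
  rewrite (_ : \int[mu]_(t in D) (_ + _) = pi *+ 2 * complex.Re (a k)); last first.
    by rewrite -Ec; apply: eq_Rintegral => t _; rewrite /= mul0r addr0.
  rewrite (_ : \int[mu]_(t in D) (_ - _) = pi *+ 2 * complex.Im (a k)); last first.
    by rewrite -sN; apply: eq_Rintegral => t _; rewrite /= mul0r add0r.
  by rewrite !mulKf//; case: (a k).
rewrite (_ : \int[mu]_(t in D) (_ + _) = pi *+ 2 * complex.Re (a k)); last first.
  by rewrite -Ec; apply: eq_Rintegral => t _; rewrite /= mul0r addr0 eN cosN.
rewrite (_ : \int[mu]_(t in D) (_ - _) = - (pi *+ 2 * complex.Im (a k))); last first.
  by rewrite -Es; apply: eq_Rintegral => t _; rewrite /= mul0r add0r eN sinN mulrN opprK.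
by rewrite mulrN !mulKf// -aRe -aIm; case: (a (- k%:Z)).
Qed.

Lemma Rintegral_comb_trig (N : nat) (u : R -> R) (w : 'rV[R]_N.*2.+1)
    (b : 'I_N.*2.+1 -> R) (r : R) :
  measurable_fun D u -> (\forall x \ae mu, D x -> `|u x| <= r) ->
  (forall k, \int[mu]_(t in D) (u t * trig k t) = b k) ->
  \int[mu]_(t in D) (u t * \sum_k w 0 k * trig k t) = \sum_k w 0 k * b k.
Proof.
move=> mu_ ur ub; have mD := @measurable_circD R.
have ik (k : 'I_N.*2.+1) : mu.-integrable D (EFin \o (fun t => u t * trig k t)).
  exact: (integrable_mul_continuous mu_ ur (@trig_continuous R N k) (trig_le1 k)).
rewrite (_ : \int[mu]_(t in D) _ =
    \int[mu]_(t in D) \sum_k w 0 k * (u t * trig k t)); last first.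
  apply: eq_Rintegral => t _; rewrite mulr_sumr; apply: eq_bigr => k _.
  by rewrite mulrCA.
rewrite Rintegral_sum => [|k].
  by apply: eq_bigr => k _; rewrite RintegralZl// ub.
have h := @integrableZl _ _ R mu D mD (w 0 k) _ (ik k).
by apply: eq_integrable h => // x _; rewrite /= EFinM.
Qed.

End FourierMoments.

(** * Membership in G_A expressed through trigonometric moments *)

Section TrigMoments.
Variables (R : realType) (N : nat) (a : int -> R[i]).
Local Notation mu := (@lebesgue_measure R).
Local Notation D := (@circD R).
Hypothesis a_conj : forall k : nat, (k <= N)%N -> a (- k%:Z) = (a k)^*.

(** The right-hand sides of the moment problem: 2 pi undoes the normalization, and the minus sign
    comes from the kernel e^{-ikt}. *)
Definition trig_moment (k : 'I_N.*2.+1) : R :=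
  if (k <= N)%N then pi *+ 2 * complex.Re (a k)
  else - (pi *+ 2 * complex.Im (a (k - N)%N)).

Let aRe (k : nat) : (k <= N)%N -> complex.Re (a (- k%:Z)) = complex.Re (a k).
Proof. by move=> /a_conj ->; case: (a k). Qed.

Let aIm (k : nat) : (k <= N)%N -> complex.Im (a (- k%:Z)) = - complex.Im (a k).
Proof. by move=> /a_conj ->; case: (a k). Qed.

Lemma GA_trig_moment (g : R -> R[i]) (k : 'I_N.*2.+1) : GA N a g ->
  \int[mu]_(t in D) (complex.Re (g t) * trig k t) = trig_moment k.
Proof.
move=> [Lg Fg].
have rng (j : nat) : (j <= N)%N -> - N%:Z <= j%:Z <= N%:Z by lia.
have rngN (j : nat) : (j <= N)%N -> - N%:Z <= - j%:Z <= N%:Z by lia.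
have moments (j : nat) (jN : (j <= N)%N) :=
  fourier_moments Lg (aRe jN) (aIm jN) (Fg _ (rng j jN)) (Fg _ (rngN j jN)).
have kN : (k - N <= N)%N by rewrite leq_subLR addnn -ltnS.
rewrite /trig_moment /trig; case: ifP => hk.
  by have [] := moments k hk.
by have [] := moments (k - N)%N kN.
Qed.

Lemma GA_of_trig_moments (u : R -> R) :
  measurable_fun D u -> (exists r, forall x, `|u x| <= r) ->
  (forall k, \int[mu]_(t in D) (u t * trig k t) = trig_moment k) ->
  GA N a (fun x => (u x)%:C).
Proof.
move=> mu_ [r ur] um.
have cos_moment (k : nat) : (k <= N)%N ->
    \int[mu]_(t in D) (u t * cos (k%:R * t)) = pi *+ 2 * complex.Re (a k).
  move=> kN; have kN2 : (k < N.*2.+1)%N by lia.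
  by have := um (Ordinal kN2); rewrite /trig_moment /trig /= kN.
have sin_moment (k : nat) : (k <= N)%N ->
    \int[mu]_(t in D) (u t * sin (k%:R * t)) = - (pi *+ 2 * complex.Im (a k)).
  case: k => [|k] kN.
    (* Frequency 0 has no sine among the functions [trig]; conjugate symmetry makes the coefficient
       at 0 real, so both sides vanish. *)
    have := aIm (leq0n N); rewrite oppr0 => a0.
    have -> : complex.Im (a 0) = 0 by lra.
    rewrite mulr0 oppr0 -[RHS](mul0r (pi *+ 2)) -Rintegral_circ_cst.
    by apply: eq_Rintegral => t _; rewrite mul0r sin0 mulr0.
  have kN2 : (N + k.+1 < N.*2.+1)%N by lia.
  have := um (Ordinal kN2); rewrite /trig_moment /trig /=.
  by rewrite leqNgt -addSnnS leq_addr/= addSnnS addKn.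
split.
  split=> //=; exists r; apply: aeW => x _; by rewrite norm_real_complex lecR.
have F (k : nat) (kN : (k <= N)%N) := fourier_real_of_moments mu_
  (ex_intro _ r ur) (aRe kN) (aIm kN) (cos_moment k kN) (sin_moment k kN).
move=> [k|k] /andP[h1 h2].
  by have [|] := F k; first lia.
by rewrite NegzE; have [|] := F k.+1; first lia.
Qed.

End TrigMoments.


(** * Existence, uniqueness and shape of the function of minimum norm *)

Theorem theorem4p1 (R : realType) (N : nat) (A : 'M[R[i]]_N.+1) (a : int -> R[i]) :
  (0 < N)%N ->
  (* A = (a_{j-k})_{j,k=0}^N is Toeplitz *)
  (forall j k : 'I_N.+1, A j k = a (j%:Z - k%:Z)) ->
  (* A is self-adjoint *)
  (forall j k : 'I_N.+1, A j k = (A k j)^*) ->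
  exists f : R -> R[i],
    [/\ GA N a f,
        linf_norm f = cA N a,
        (forall g : R -> R[i], GA N a g -> linf_norm g = cA N a ->
           \forall x \ae lebesgue_measure, circD x -> g x = f x) &
        exists n : nat, (n <= N)%N /\
          ((n = 0%N /\ exists z : R[i], const_fun z f /\ `|z| = (cA N a)%:C)
           \/ alt_step (cA N a) n f)].
Proof.
move=> _ toeplitz selfadj.
pose mu := @lebesgue_measure R; pose D := @circD R.
have a_conj (k : nat) : (k <= N)%N -> a (- k%:Z) = (a k)^*.
  (* Row 0 and column 0 of the matrix already contain every coefficient from -N to N. *)
  move=> kN; have := selfadj ord0 (Ordinal (kN : (k < N.+1)%N)).
  by rewrite !toeplitz /= sub0r subr0.
pose b := @trig_moment R N a.
have root_count (w : 'rV[R]_N.*2.+1) : w != 0 -> forall s : seq R, uniq s ->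
    (forall x, x \in s -> D x /\ \sum_k w 0 k * trig k x = 0) -> (size s <= N.*2)%N.
  by move=> w0 s us; exact: trig_roots w0 s us.
have ae_neq0 (w : 'rV[R]_N.*2.+1) : w != 0 ->
    \forall x \ae mu, D x -> \sum_k w 0 k * trig k x != 0.
  move=> w0; have [s _ sP] := bounded_subset_seq (root_count w w0).
  apply: (finite_ae (s := s)) => x Dx; apply: contraNN => /eqP px.
  exact/sP.
have [w [c [w0 c0 wc]]] :=
  L1_dual_extremal (@trig_continuous R N) (@trig_le1 R N) b ae_neq0.
pose p x := \sum_k w 0 k * trig k x.
pose u x := c * Num.sg (p x).
have p_ae := ae_neq0 w w0.
have p_cont : continuous p.
  have := @continuous_big R _ +%R 0 xpredT add_continuous _
    (index_enum 'I_N.*2.+1) (fun k x => w 0 k * trig k x).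
  by apply=> k _ x; apply: cvgMl_tmp; exact: trig_continuous.
have mp : measurable_fun D p.
  by apply: measurable_funTS; exact: continuous_measurable_fun.
have mu_ : measurable_fun D u.
  by apply: measurable_funM => //; exact: measurable_fun_sgr.
have u_le x : `|u x| <= c.
  rewrite /u normrM normr_sg ger0_norm// -[leRHS]mulr1 ler_wpM2l//.
  by rewrite lern1 leq_b1.
have p_bnd : exists M, forall x, `|p x| <= M.
  exists (\sum_k `|w 0 k|) => x; apply: (le_trans (ler_norm_sum _ _ _)).
  by apply: ler_sum => k _; rewrite normrM -[leRHS]mulr1 ler_wpM2l// trig_le1.
have ip : mu.-integrable D (EFin \o (fun x => `|p x|)).
  have [M pM] := p_bnd; apply: (@bounded_integrable _ _ M).
    exact: measurableT_comp.
  by move=> x; rewrite normr_id.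
have u_ae : \forall x \ae mu, D x -> `|u x| <= c by apply: aeW.
have mD := @measurable_circD R.
(* Both [Re g] and u have the moments prescribed by A, so their pairings with p agree, and u p = c
   |p|. *)
have pairing (g : R -> R[i]) : GA N a g ->
    \int[mu]_(x in D) (complex.Re (g x) * p x) = c * \int[mu]_(x in D) `|p x|.
  move=> GAg; have [[mRe _ [r gr]] _] := GAg.
  have bRe : \forall x \ae mu, D x -> `|complex.Re (g x)| <= r.
    by apply: (ae_circS gr) => x _ /norm_Re_Im_le[].
  rewrite (Rintegral_comb_trig _ mRe bRe (fun k => GA_trig_moment a_conj k GAg)).
  rewrite -(Rintegral_comb_trig w mu_ u_ae wc) -RintegralZl//.
  by apply: eq_Rintegral => x _; rewrite -/(p x) /u -mulrA -normrEsg.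
have p_gt0 : 0 < \int[mu]_(x in D) `|p x| by exact: Rintegral_norm_gt0.
pose f x : R[i] := (u x)%:C.
have GAf : GA N a f by apply: (GA_of_trig_moments a_conj) => //; exists c.
have c_le (g : R -> R[i]) : GA N a g -> c <= linf_norm g.
  move=> GAg; have [Lg _] := GAg; have [mRe _ _] := Lg.
  apply: ge_linf_norm => // r gr.
  have bRe : \forall x \ae mu, D x -> `|complex.Re (g x)| <= r.
    by apply: (ae_circS gr) => x _ /norm_Re_Im_le[].
  rewrite -(ler_pM2r p_gt0) -(pairing g GAg).
  exact: Rintegral_mul_le.
have f_norm x : `|f x| <= c%:C by rewrite norm_real_complex lecR.
have normf : linf_norm f = c.
  apply/eqP; rewrite eq_le c_le// andbT; apply: linf_norm_le.
  by apply: aeW => x _; exact: f_norm.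
have cAE : cA N a = c.
  apply/eqP; rewrite eq_le; apply/andP; split.
    rewrite -normf; apply: ge_inf; last by exists f.
    by exists c => _ [g GAg <-]; exact: c_le.
  apply: lb_le_inf; first by exists (linf_norm f); exists f.
  by move=> _ [g GAg <-]; exact: c_le.
rewrite cAE; exists f; split => //.
  move=> g GAg ng; have [Lg _] := GAg; have [mRe mIm _] := Lg.
  have gc := linf_norm_bound Lg; rewrite ng in gc.
  have bRe : \forall x \ae mu, D x -> `|complex.Re (g x)| <= c.
    by apply: (ae_circS gc) => x _ /norm_Re_Im_le[].
  have Reg := extremal_sgr_ae mRe bRe mp p_bnd p_ae (pairing g GAg).
  apply: (ae_circS2 Reg (ae_circS2 gc p_ae (fun x _ h1 h2 => conj h1 h2))).
  move=> x _ Re_gx [gx px].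
  (* Since |g| <= c while (Re g)^2 = c^2 where p is nonzero, no room is left for an imaginary
     part. *)
  have : complex.Im (g x) = 0.
    move: gx; rewrite normc_def lecR Re_gx exprMn sqr_sg px mulr1.
    rewrite -[leRHS]ger0_norm// -sqrtr_sqr ler_sqrt ?sqr_ge0// gerDl => h.
    by apply/eqP; rewrite -sqrf_eq0 eq_le h sqr_ge0.
  by move: Re_gx; case: (g x) => /= v v' -> ->.
have p_period : p (pi *+ 2) = p 0.
  by apply: eq_bigr => k _; rewrite trig_period.
have [n [nN pat]] := periodic_sign_pattern p_cont p_period (root_count w w0).
(* If c = 0 then f vanishes whatever the signs of p, and it counts as order 0, since an alternating
   step function has positive height. *)
have [c_eq0|c_neq0] := eqVneq c 0.
  exists 0%N; split=> //; left; split=> //; exists 0; split.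
    by apply: aeW => x _; rewrite /f /u c_eq0 mul0r.
  by rewrite c_eq0 normr0.
exists n; split=> //; case: pat => [[-> [e e1 he]]|[n0 [t [s [s1 t0 t_incr tn hs]]]]].
  left; split=> //; exists (c * e)%:C; split.
    by apply: (ae_circS p_ae) => x Dx px; rewrite /f /u he.
  rewrite norm_real_complex normrM ger0_norm//.
  by case: e1 => ->; rewrite ?normrN normr1 mulr1.
right; split; first by rewrite lt_def c_neq0.
split=> //; exists t, s; split=> //.
apply: (ae_circS p_ae) => x Dx px; have [h1 h2] := hs x Dx px.
split=> [i ilt /(h1 i ilt) sx|/h2 sx]; rewrite /f /u sx.
  by rewrite mulrA (mulrC c).
by rewrite mulrN mulrC.
Qed.
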